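(* Let $p$ be an odd prime and let $x$ be a variable. Then $$\sum_{k=0}^{p-1}\binom{2k}{k}\binom{3k}{k}\binom{6k}{3k}\bigl(x(1-432x)\bigr)^k\equiv \Bigl(\sum_{k=0}^{p-1}\binom{3k}{k}\binom{6k}{3k}x^k\Bigr)^2 \pmod{p^2}.$$
   Context: The congruence is between polynomials in $x$ with integer coefficients: it means that the difference of the two sides, as an element of $\mathbb{Z}[x]$, has all coefficients divisible by $p^2$. *)

(* Defs.v *)
From mathcomp Require Export all_boot all_order all_algebra.

Set Implicit Arguments.
Unset Strict Implicit.
Unset Printing Implicit Defensive.

(* Main.v *)
Require Import Defs.
From mathcomp Require Import all_boot all_order all_algebra.
From mathcomp Require Import ring zify.

Import GRing.Theory.
Local Open Scope ring_scope.

(** Write [a k] for the product of [binomial (3k) k] and [binomial (6k) (3k)],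
and [b k] for [binomial (2k) k * a k].  The two sides [L] and [S ^+ 2] are
compared coefficient by coefficient; the coefficients of degree less than [p]
agree exactly, and those of degree at least [p] all vanish modulo [p ^ 2].

In degree less than [p] truncating the sums at [p] is harmless, so the claim
there is the power series identity of Clausen type
   (sum of a k x^k) ^ 2 = sum of b k (x (1 - c x))^k,          c = 432.
It holds for every sequence with [a 0 = 1] and
   (k + 1)^2 a (k + 1) = (c k (k + 1) + d) a k
([coef_clausen]; here [d = 60], see [sexticS]).  With [u = 1 - c x],
[z = x u] and the derivation [D = u x d/dx], the recurrence for [a] says that
its generating function [f] satisfies [D^2 f = d z f].  Hence [f ^ 2] is killed
by the symmetric square of that equation,
   D^3 g = 2 d (D (z g) + z D g).
The recurrence for [b] gives a third order equation in the variable [z] for the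
generating function of [b], and the chain rule [D z = (1 - 2 c x) z] turns it
into the same equation.  A solution is determined by its constant term, because
the leading part of the operator multiplies the coefficient of degree [n] by
[n ^ 3].  All of this is done with polynomials over the integers, modulo [x^N].

In degree [i >= p] divisibility comes from carries: [p] divides a binomial
coefficient [binomial m n] as soon as the last base [p] digit of [m] is less
than that of [n].  For [k < p] this yields that [p] divides [a k] when
[6 k >= p], that [p ^ 2] divides it when [6 k >= 5 p], and that [p] divides
[binomial (2k) k] when [2 k >= p].  The [k]-th term of [L] has degree at most
[2 k], so it contributes in degree [i] only when [2 k >= p].  A term
[a j * a (i - j)] of [S ^+ 2] has [j + (i - j) >= p]: either both factors are
divisible by [p], or one index is below [p / 6] and the other one above
[5 p / 6]. *)

(** * Recurrences of the coefficients *)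

Definition sextic (k : nat) : nat := ('C(3 * k, k) * 'C(6 * k, 3 * k))%N.

Lemma sextic_fact k :
  (sextic k * (k`! * (2 * k)`! * (3 * k)`!) = (6 * k)`!)%N.
Proof.
rewrite -(@bin_fact (6 * k) (3 * k)); last by lia.
rewrite (_ : 6 * k - 3 * k = 3 * k)%N; last by lia.
have := @bin_fact (3 * k) k ltac:(lia).
rewrite (_ : 3 * k - k = 2 * k)%N /sextic; last by lia.
by move=> {2}<-; ring.
Qed.

Lemma sexticS k :
  (k.+1 ^ 2 * sextic k.+1 = 12 * ((6 * k + 1) * (6 * k + 5)) * sextic k)%N.
Proof.
have e2 : (2 * k.+1 = (2 * k).+2)%N by lia.
have e3 : (3 * k.+1 = (3 * k).+3)%N by lia.
have e6 : (6 * k.+1 = (6 * k).+4.+2)%N by lia.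
have := sextic_fact k.+1; rewrite e2 e3 e6 !factS -(sextic_fact k).
set M := (k`! * (2 * k)`! * (3 * k)`!)%N.
have M_gt0 : (0 < M)%N by rewrite !muln_gt0 !fact_gt0.
(* The recurrence is the factorial identity divided by this factor. *)
move=> E; have c_gt0 : (0 < 6 * k.+1 * (2 * k).+1 * (3 * k).+1 * (3 * k).+2 * M)%N.
  by rewrite muln_gt0 M_gt0.
apply/eqP; rewrite -(eqn_pmul2l c_gt0); apply/eqP.
transitivity (sextic k.+1 * (k.+1 * k`! * ((2 * k).+2 * ((2 * k).+1 * (2 * k)`!))
  * ((3 * k).+3 * ((3 * k).+2 * ((3 * k).+1 * (3 * k)`!)))))%N.
  by rewrite /M; ring.
by rewrite E; ring.
Qed.

Lemma central_binS k :
  (k.+1 * 'C(2 * k.+1, k.+1) = 2 * (2 * k + 1) * 'C(2 * k, k))%N.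
Proof.
have e2 : (2 * k.+1 = (2 * k).+2)%N by lia.
have F0 := @bin_fact (2 * k) k ltac:(lia).
have F1 := @bin_fact (2 * k.+1) k.+1 ltac:(lia).
rewrite (_ : 2 * k - k = k)%N in F0; last by lia.
rewrite (_ : 2 * k.+1 - k.+1 = k.+1)%N in F1; last by lia.
move: F1; rewrite [in RHS]e2 !factS -F0 => E.
have c_gt0 : (0 < k.+1 * (k`! * k`!))%N by rewrite !muln_gt0 !fact_gt0.
apply/eqP; rewrite -(eqn_pmul2l c_gt0); apply/eqP.
transitivity ('C(2 * k.+1, k.+1) * (k.+1 * k`! * (k.+1 * k`!)))%N; first by ring.
by rewrite E; ring.
Qed.

(** * Divisibility by carries *)

(** Induct on [n] through [n * 'C(m, n) = m * 'C(m.-1, n.-1)]: the factor [n]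
is invertible modulo [p], and lowering [m] and [n] together preserves the
comparison of last digits until [p] divides [m]. *)
Lemma prime_dvd_bin p m n : prime p -> (m %% p < n %% p)%N -> (p %| 'C(m, n))%N.
Proof.
move=> p_pr; elim: n m => [|n IHn] m lt_mn; first by rewrite mod0n in lt_mn.
have p_gt1 := prime_gt1 p_pr.
have n_ndvd : ~~ (p %| n.+1)%N by rewrite /dvdn -lt0n; lia.
case: m lt_mn => [|m] lt_mn; first by rewrite bin0n dvdn0.
have : (p %| n.+1 * 'C(m.+1, n.+1))%N; last first.
  by rewrite Euclid_dvdM // (negPf n_ndvd).
rewrite -mul_bin_diag Euclid_dvdM //; case: (boolP (p %| m.+1)%N) => //= m_ndvd.
apply: IHn.
move: lt_mn n_ndvd m_ndvd; rewrite /dvdn !modnS /dvdn.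
by case: eqP => //; case: eqP.
Qed.

(** The same criterion with the quotients [q] and [r] of [m] and [n] supplied,
which leaves linear side conditions.  That [m - q * p]
is below [p] follows from the last two hypotheses. *)
Lemma prime_dvd_bin_carry p m n q r : prime p ->
    (q * p <= m)%N -> (r * p <= n < r.+1 * p)%N -> (m + r * p < n + q * p)%N ->
  (p %| 'C(m, n))%N.
Proof.
move=> p_pr le_qm /andP[le_rn lt_nr] lt_mn; apply: prime_dvd_bin => //.
have -> : (m = q * p + (m - q * p))%N by lia.
have -> : (n = r * p + (n - r * p))%N by lia.
by rewrite !modnMDl !modn_small; lia.
Qed.

Lemma dvd_central_bin p k :
  prime p -> (k < p)%N -> (p <= 2 * k)%N -> (p %| 'C(2 * k, k))%N.
Proof. by move=> p_pr ? ?; apply: (@prime_dvd_bin_carry p _ _ 1 0) => //; lia. Qed.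

(** The position of [k] among the multiples of [p / 6] decides which of the two
binomial coefficients has a carry. *)
Lemma dvd_sextic p k :
  prime p -> (k < p)%N -> (p <= 6 * k)%N -> (p %| sextic k)%N.
Proof.
move=> p_pr lt_kp le_p6k; rewrite /sextic.
have [lt1|ge1] := ltnP (6 * k) (2 * p).
  by apply/dvdn_mull/(@prime_dvd_bin_carry p _ _ 1 0) => //; lia.
have [lt2|ge2] := ltnP (6 * k) (3 * p).
  by apply/dvdn_mulr/(@prime_dvd_bin_carry p _ _ 1 0) => //; lia.
have [lt3|ge3] := ltnP (6 * k) (4 * p).
  by apply/dvdn_mull/(@prime_dvd_bin_carry p _ _ 3 1) => //; lia.
by apply/dvdn_mulr/(@prime_dvd_bin_carry p _ _ 2 0) => //; lia.
Qed.

(** In the last sixth of the range both binomial coefficients have a carry. *)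
Lemma sqr_dvd_sextic p k :
  prime p -> (k < p)%N -> (5 * p <= 6 * k)%N -> (p ^ 2 %| sextic k)%N.
Proof.
move=> p_pr lt_kp le_5p6k; apply: dvdn_mul.
  by apply: (@prime_dvd_bin_carry p _ _ 2 0) => //; lia.
by apply: (@prime_dvd_bin_carry p _ _ 5 2) => //; lia.
Qed.

(** * The Euler operator and polynomials modulo a power of the variable *)

Definition theta (f : {poly int}) : {poly int} := 'X * f^`().

Lemma coef_theta f i : (theta f)`_i = i%:R * f`_i.
Proof. by rewrite coefXM coef_deriv; case: i => [|i] /=; rewrite ?mul0r ?mulr_natl. Qed.

Lemma coef_theta_subXM0 f g : (theta f - 'X * g)`_0 = 0.
Proof. by rewrite coefB coef_theta mul0r coefXM subr0. Qed.

Lemma coef_theta_subXMS f g i :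
  (theta f - 'X * g)`_i.+1 = i.+1%:R * f`_i.+1 - g`_i.
Proof. by rewrite coefB coef_theta coefXM. Qed.

Lemma thetaD f g : theta (f + g) = theta f + theta g.
Proof. by rewrite /theta derivD mulrDr. Qed.
Lemma thetaN f : theta (- f) = - theta f.
Proof. by rewrite /theta derivN mulrN. Qed.
Lemma thetaM f g : theta (f * g) = theta f * g + f * theta g.
Proof. by rewrite /theta derivM mulrDr mulrA mulrCA. Qed.
Lemma theta_nat n : theta n%:R = 0.
Proof. by rewrite /theta derivMn derivC mul0rn mulr0. Qed.
Lemma theta1 : theta 1 = 0.
Proof. exact: (theta_nat 1). Qed.
Lemma thetaC c : theta c%:P = 0.
Proof. by rewrite /theta derivC mulr0. Qed.
Lemma thetaX : theta 'X = 'X.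
Proof. by rewrite /theta derivX mulr1. Qed.
Definition thetaE := (thetaD, thetaN, thetaM, theta_nat, theta1, thetaC, thetaX).

(** Congruence to zero modulo ['X^N], the precision to which generating
functions are known by their truncations. *)
Definition vanish N (f : {poly int}) := forall i, (i < N)%N -> f`_i = 0.

Lemma vanishD N f g : vanish N f -> vanish N g -> vanish N (f + g).
Proof. by move=> hf hg i lt_iN; rewrite coefD hf ?hg ?addr0. Qed.
Lemma vanishN N f : vanish N f -> vanish N (- f).
Proof. by move=> hf i lt_iN; rewrite coefN hf ?oppr0. Qed.
Lemma vanishMl N f g : vanish N g -> vanish N (f * g).
Proof.
move=> hg i lt_iN; rewrite coefM big1 // => j _.
by rewrite hg ?mulr0 // (leq_ltn_trans (leq_subr _ _)).
Qed.
Lemma vanishXM N f : vanish N f -> vanish N.+1 ('X * f).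
Proof. by move=> hf [|i] lt_iN; rewrite coefXM //= hf. Qed.
Lemma vanish_theta N f : vanish N f -> vanish N (theta f).
Proof. by move=> hf i lt_iN; rewrite coef_theta hf ?mulr0. Qed.
Lemma vanish_leq M N f : (M <= N)%N -> vanish N f -> vanish M f.
Proof. by move=> le_MN hf i lt_iM; apply/hf/(leq_trans lt_iM). Qed.
Lemma vanish_comp N f g : vanish N f -> vanish N (f \Po ('X * g)).
Proof.
move=> hf; have -> : f = drop_poly N f * 'X^N.
  rewrite -{1}(poly_take_drop N f) [take_poly _ _](_ : _ = 0) ?add0r //.
  by apply/polyP => i; rewrite coef_take_poly coef0; case: ifP => // /hf.
rewrite comp_polyM comp_Xn_poly exprMn mulrCA.
move=> i lt_iN; by rewrite coefXnM lt_iN.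
Qed.


(** * A Clausen identity *)

Section Clausen.
Variables c d : int.
Let u : {poly int} := 1 - c%:P * 'X.
Let v : {poly int} := 1 - 2%:R * c%:P * 'X.
Let z : {poly int} := 'X * u.

Let D (f : {poly int}) : {poly int} := u * theta f.

(** The recurrence [(k + 1)^2 a (k + 1) = (c k (k + 1) + d) a k], as a
differential operator killing the generating function of [a].  It satisfies
[u * quadop f = D (D f) - d z f]. *)
Definition quadop (f : {poly int}) :=
  theta (theta f) - 'X * (c%:P * (theta (theta f) + theta f) + d%:P * f).

(** The operator, in the variable substituted by [z], that encodes the recurrence
of [binomial (2k) k * a k]; its polynomial part is
[2 (2 theta + 1) (c theta (theta + 1) + d)]. *)
Definition cubop (f : {poly int}) :=
  theta (theta (theta f)) - 'X * (4%:R * c%:P * theta (theta (theta f))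
    + 6%:R * c%:P * theta (theta f) + (2%:R * c%:P + 4%:R * d%:P) * theta f
    + 2%:R * d%:P * f).

(** The symmetric square of the equation [D (D f) = d z f]. *)
Definition symop (f : {poly int}) :=
  D (D (D f)) - 2%:R * d%:P * (D (z * f) + z * D f).

(** With [r = D (D f) - d z f] one has
[D (D (f ^+ 2)) = 2 (D f) ^+ 2 + 2 d z f ^+ 2 + 2 f r]; differentiating once
more leaves only terms with the factor [r] besides those of [symop]. *)
Lemma symop_sqr f :
  symop (f ^+ 2) = 4%:R * (u * quadop f) * D f + 2%:R * D (f * (u * quadop f)).
Proof. by rewrite /symop /quadop /D /z /u expr2 !thetaE; ring. Qed.

Lemma D_comp f : D (f \Po z) = v * (theta f \Po z).
Proof.
rewrite /D /theta deriv_comp comp_polyM comp_polyX.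
have -> : z^`() = v.
  by rewrite /z /u !(derivM, derivB, derivX, derivC, derivE) /v; ring.
by rewrite /z; ring.
Qed.

(** Since [D] acts on polynomials in [z] as [v] times the Euler operator of [z],
the third derivative produces [v ^+ 3]; the relation [v ^+ 2 = 1 - 4 c z] makes
the result a multiple of [v] by a polynomial in [z]. *)
Lemma symop_comp f : symop (f \Po z) = v * (cubop f \Po z).
Proof.
have Dz : D z = v * z by rewrite /D /z /v /u !thetaE; ring.
have Dv : D v = - (2%:R * c%:P * z) by rewrite /D /z /v /u !thetaE; ring.
have DM g h : D (g * h) = D g * h + g * D h by rewrite /D thetaM; ring.
have DN g : D (- g) = - D g by rewrite /D thetaN mulrN.
have DB g h : D (g + h) = D g + D h by rewrite /D thetaD mulrDr.
have Dn n : D n%:R = 0 by rewrite /D theta_nat mulr0.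
have DC a : D a%:P = 0 by rewrite /D thetaC mulr0.
have v2 : v ^+ 2 = 1 - 4%:R * c%:P * z by rewrite /v /z /u; ring.
have natz n : n%:R \Po z = n%:R by rewrite -(polyC_natr int) comp_polyC.
rewrite /symop /cubop !(Dn, DC, Dz, Dv, DM, DN, DB, D_comp).
move: (theta f) (theta (theta f)) (theta (theta (theta f))) => f1 f2 f3.
rewrite !(natz, comp_polyB, comp_polyD, comp_polyM, comp_polyX, comp_polyC).
transitivity (v * (v ^+ 2 * (f3 \Po z) - z * (6%:R * c%:P * (f2 \Po z)
  + (2%:R * c%:P + 4%:R * d%:P) * (f1 \Po z) + 2%:R * d%:P * (f \Po z)))).
  by ring.
by rewrite v2; ring.
Qed.

Lemma symopB f g : symop (f - g) = symop f - symop g.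
Proof. by rewrite /symop /D !thetaE; ring. Qed.

(** Uniqueness: if ['X^m] divides [f], then [symop f] agrees with the third
iterate of [theta] modulo ['X^m.+1], so its coefficient of degree [m] is [m ^ 3]
times that of [f]. *)
Lemma vanish_symop N (f : {poly int}) :
  f`_0 = 0 -> vanish N (symop f) -> vanish N f.
Proof.
move=> f0 symf; suff : forall m, (m <= N)%N -> vanish m f by apply.
have vD m g : vanish m g -> vanish m (D g).
  by move=> hg; apply/vanishMl/vanish_theta.
have vDB m g : vanish m g -> vanish m.+1 (D g - theta g).
  move=> hg; rewrite (_ : _ - _ = 'X * (- c%:P * theta g)).
    by apply/vanishXM/vanishMl/vanish_theta.
  by rewrite /D /u; ring.
elim=> [|m IHm] lt_mN //; have fm := IHm (ltnW lt_mN).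
suff t3 : vanish m.+1 (theta (theta (theta f))).
  move=> i; rewrite ltnS leq_eqVlt => /orP[/eqP-> | /fm //].
  have := t3 m (ltnSn m); rewrite !coef_theta; case: m {IHm lt_mN fm t3} => // m.
  by do 3! [move/eqP; rewrite mulf_eq0 Num.Theory.pnatr_eq0 /= => /eqP].
have f1 := vanish_theta _ _ fm; have f2 := vanish_theta _ _ f1.
have -> : theta (theta (theta f)) = symop f
    - (D (D (D f - theta f)) + D (D (theta f) - theta (theta f))
       + (D (theta (theta f)) - theta (theta (theta f))))
    + 'X * (2%:R * d%:P * (u * (v * f + 2%:R * D f))).
  by rewrite /symop /D /z /v /u !thetaE; ring.
apply: vanishD; first apply: vanishD; first exact: vanish_leq symf.
  by apply/vanishN/vanishD; [apply: vanishD|]; auto.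
by apply/vanishXM/vanishMl/vanishMl/vanishD; apply: vanishMl; auto.
Qed.

Variable a : nat -> int.
Hypothesis aS : forall k, 
  k.+1%:R ^+ 2 * a k.+1 = (c * (k%:R * k.+1%:R) + d) * a k.
Hypothesis a0 : a 0%N = 1.

Let b k := 'C(2 * k, k)%:R * a k.

Lemma vanish_quadop N : vanish N (quadop (\poly_(k < N) a k)).
Proof.
case=> [|i] lt_iN; first exact: coef_theta_subXM0.
rewrite coef_theta_subXMS !(coefCM, coefD, coef_theta, coef_poly).
by rewrite lt_iN (ltnW lt_iN) mulrA -expr2 aS; ring.
Qed.

Lemma vanish_cubop N : vanish N (cubop (\poly_(k < N) b k)).
Proof.
case=> [|i] lt_iN; first exact: coef_theta_subXM0.
rewrite coef_theta_subXMS.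
have nC n : n%:R = (n%:R)%:P :> {poly int} by rewrite polyC_natr.
rewrite !nC -!polyCM -!polyCD !(coefD, coefCM, coef_theta, coef_poly).
rewrite lt_iN (ltnW lt_iN) /b.
transitivity ((i.+1%:R * 'C(2 * i.+1, i.+1)%:R) * (i.+1%:R ^+ 2 * a i.+1)
   - ((4 * c * i%:R ^+ 3 + 6 * c * i%:R ^+ 2 + (2 * c + 4 * d) * i%:R + 2 * d)
     * ('C(2 * i, i)%:R * a i))).
  by ring.
by rewrite -natrM central_binS !natrM aS; ring.
Qed.

Lemma coef_clausen N i : (i < N)%N ->
  ((\poly_(k < N) b k) \Po z)`_i = ((\poly_(k < N) a k) ^+ 2)`_i.
Proof.
case: N => // N lt_iN.
set f := (_ \Po z); set g := (_ ^+ 2).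
apply/eqP; rewrite -subr_eq0 -coefB; apply/eqP; move: i lt_iN.
apply: vanish_symop.
  have z0 : z.[0] = 0 by rewrite /z hornerM hornerX mul0r.
  rewrite coefB /f /g -!horner_coef0 horner_comp z0 horner_exp !horner_coef0.
  by rewrite !coef_poly /= /b a0 bin0 mulr1 expr1n subrr.
rewrite symopB symop_sqr symop_comp; apply: vanishD.
  exact/vanishMl/vanish_comp/vanish_cubop.
have vq := vanishMl _ u _ (vanish_quadop N.+1).
apply/vanishN/vanishD; first by rewrite mulrC; do 2! apply: vanishMl.
by do 2! apply: vanishMl; apply/vanish_theta/vanishMl.
Qed.
End Clausen.

Lemma coef_expX_subZX_eq0 (c : int) k i : (2 * k < i)%N ->
  (('X * (1 - c *: 'X)) ^+ k : {poly int})`_i = 0.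
Proof.
move=> lt_ki; apply: nth_default; apply: leq_trans lt_ki.
apply: leq_trans (size_poly_exp_leq _ _) _; rewrite ltnS leq_mul2r; apply/orP; right.
rewrite -[2%N]/(3.-1) -!subn1 leq_sub2r //.
apply: leq_trans (size_polyMleq _ _) _; rewrite size_polyX /=.
apply: leq_trans (size_polyD _ _) _; rewrite geq_max size_poly1 size_polyN.
by apply: leq_trans (size_scale_leq _ _) _; rewrite size_polyX.
Qed.

Theorem theorem3p1 (p : nat) (p_prime : prime p) (p_odd : odd p) :
  let L : {poly int} :=
    \sum_(0 <= k < p)
       ('C(2 * k, k) * 'C(3 * k, k) * 'C(6 * k, 3 * k))%N%:Z
         *: ('X * (1 - 432%:Z *: 'X)) ^+ k in
  let S : {poly int} :=
    \sum_(0 <= k < p) ('C(3 * k, k) * 'C(6 * k, 3 * k))%N%:Z *: 'X^k in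
  forall i : nat, ((p ^ 2)%N%:Z %| (L - S ^+ 2)`_i)%Z.
Proof.
move=> L S i; set a := fun k => (sextic k)%:Z.
have defS : S = \poly_(k < p) a k by rewrite poly_def /S big_mkord.
have defL : L = (\poly_(k < p) ('C(2 * k, k)%:R * a k))
                  \Po ('X * (1 - 432%:Z%:P * 'X)).
  rewrite poly_def /L big_mkord raddf_sum; apply: eq_bigr => k _ /=.
  rewrite comp_polyZ comp_Xn_poly mul_polyC natz -PoszM.
  by rewrite /sextic mulnA.
have aS k : k.+1%:R ^+ 2 * a k.+1 = (432%:Z * (k%:R * k.+1%:R) + 60%:Z) * a k.
  rewrite /a; move: (sextic k) (sextic k.+1) (sexticS k) => s0 s1.
  move/(congr1 (fun n => n%:R : int)); rewrite !(natrM, natrD, natrX) !natz.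
  by rewrite -!(natz s0) -!(natz s1) -!(natz k.+1) -!(natz k) => ->; ring.
have [lt_ip | le_pi] := ltnP i p.
  by rewrite coefB defL defS (@coef_clausen _ _ a aS) ?subrr ?dvdz0.
rewrite coefB; apply: rpredB.
  rewrite /L big_mkord coef_sum; apply: rpred_sum => -[k lt_kp] _ /=.
  rewrite coefZ -mulnA.
  have [lt_2ki | le_i2k] := ltnP (2 * k) i.
    by rewrite coef_expX_subZX_eq0 // mulr0 dvdz0.
  apply: dvdz_mulr; rewrite /dvdz !absz_nat; apply: dvdn_mul.
    by apply: dvd_central_bin => //; lia.
  by apply: dvd_sextic => //; lia.
rewrite expr2 coefM; apply: rpred_sum => -[j lt_ji] _ /=.
rewrite defS !coef_poly; case: ltnP => [lt_jp | _]; last by rewrite mul0r dvdz0.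
case: ltnP => [lt_ijp | _]; last by rewrite mulr0 dvdz0.
rewrite -PoszM /dvdz !absz_nat.
have [le_5pj | lt_j5p] := leqP (5 * p) (6 * j).
  by apply/dvdn_mulr/sqr_dvd_sextic.
have [le_5pij | lt_ij5p] := leqP (5 * p) (6 * (i - j)).
  by apply/dvdn_mull/sqr_dvd_sextic.
by apply: dvdn_mul; apply: dvd_sextic => //; lia.
Qed.
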